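(* Let $\mathcal A=(Q,\{a,b\},\delta)$ be an automaton in which $a$ is of type $[1,2]\backslash 3$ with $3a=1$ (with $1,2,3$ distinct states) and $b$ is of type $[x,y]\backslash z$ with $zb=x$ (with $x,y,z$ distinct states, not necessarily different from $1,2,3$). Then $\mathcal A$ is proper and $3$-compressible if and only if all of the following conditions hold: (1) if $z=1$, then $y=3$ and ($xa\ne 2$ or $2b\ne 3$); (2) if $z=2$ and $3\notin\{x,y\}$, then $1\in\{x,y\}$ and $3b\in\{x,y\}$; (3) if $z=2$ and $3\in\{x,y\}$, then, for $q\in\{x,y\}\setminus\{3\}$, $qa\ne 2$ or $1b\ne y$; (4) if $b=[x,y]\backslash z$ with $z\notin\{1,2\}$, $x\in\{1,2\}$ and $za\in\{1,2\}$, then $y=3$. Moreover, if $\mathcal A$ is proper and $3$-compressible, then at least one of the words $b^2a^2$, $b^2ab^2$, $a^2b^2$, $a^2ba^2$ $3$-compresses $\mathcal A$.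
   Context: A (semi)automaton is $\mathcal A=(Q,\Sigma,\delta)$ with $Q$ a finite set of states, $\Sigma=\{a,b\}$, and $\delta:Q\times\Sigma\to Q$ total. Words act on states from the right, letter by letter from left to right: $qw$ is the state reached from $q$ by reading $w$, and $Qw=\{qw:q\in Q\}$. A word $w$ $3$-compresses $\mathcal A$ if $|Q|-|Qw|\ge 3$; $\mathcal A$ is $3$-compressible if some word $3$-compresses it. A $3$-compressible automaton is proper if no word of length $3$ $3$-compresses it. A letter $c$ is of type $[p,q]\backslash r$, also written $c=[p,q]\backslash r$, for distinct states $p,q,r$, if $pc=qc$, no other two distinct states have the same image under $c$, and $Q\setminus Qc=\{r\}$.
   Formalization: Condition (4) is proved as ''if z∉{1,2}, then x∈{1,2}, za∈{1,2} and y=3''; as printed the ''if'' direction fails, e.g. a: 1→2, 2→2, 3→1, 4→4 and b: 1→2, 2→2, 3→3, 4→1, where (1)–(4) hold but aba 3-compresses the automaton. *)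

(* Defs.v *)
(* World: Mathematical Components. *)
From mathcomp Require Import all_boot.

Set Implicit Arguments.
Unset Strict Implicit.
Unset Printing Implicit Defensive.

Variant letter := La | Lb.

(* Words act on the right and are read from left to right. *)
Definition act (Q : finType) (Sigma : Type) (delta : Q -> Sigma -> Q)
  (q : Q) (w : seq Sigma) : Q := foldl delta q w.

Definition image_word (Q : finType) (Sigma : Type) (delta : Q -> Sigma -> Q)
  (w : seq Sigma) : {set Q} := [set act delta q w | q : Q].

(* The truncated subtraction is harmless, since #|Qw| <= #|Q|. *)
Definition compresses (k : nat) (Q : finType) (Sigma : Type)
  (delta : Q -> Sigma -> Q) (w : seq Sigma) : bool :=
  k <= #|Q| - #|image_word delta w|.

Definition compressible (k : nat) (Q : finType) (Sigma : Type)
  (delta : Q -> Sigma -> Q) : Prop :=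
  exists w : seq Sigma, compresses k delta w.

(* Only meaningful together with [compressible 3 delta], which is not
   included here. *)
Definition proper_automaton (Q : finType) (Sigma : Type) (delta : Q -> Sigma -> Q)
  : Prop :=
  forall w : seq Sigma, size w = 3 -> ~~ compresses 3 delta w.

(* The letter c is of type [p,q]\r. *)
Definition letter_type (Q : finType) (Sigma : Type) (delta : Q -> Sigma -> Q)
  (c : Sigma) (p q r : Q) : Prop :=
  [/\ uniq [:: p; q; r],
      delta p c = delta q c,
      forall s t : Q,
        s != t -> delta s c = delta t c -> [set s; t] = [set p; q]
    & ~: image_word delta [:: c] = [set r]].

(* Main.v *)
Require Import Defs.
From mathcomp Require Import all_boot.

Set Implicit Arguments.
Unset Strict Implicit.
Unset Printing Implicit Defensive.

(** Write 1, 2, 3 for q1, q2, q3.  Everything is read off from the set C of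
states missed by a word: reading one more letter turns C into [lose delta C c].
If c is of type [p,q]\r, then C turns into r together with the images of the
states of C, except that when C meets {p,q} one state of C is forgotten: its
image is still reached, from the other state of the merged pair.  So
(lemmas [lose_free] and [lose_hit]) the number of missed states grows by one
when C avoids {p,q} and stays the same otherwise.

Since 3a = 1 and zb = x, the word aa misses {3,1} and bb misses {z,x}, and a
further repetition of the same letter changes nothing; more generally every
{3,t} with t in {1,2} becomes {3,1} under a.  So once a run of one letter has
stalled in this way, only a change of letter can help.  The situation is
symmetric in the two letters.

Three missed states after three letters are governed by six membership tests,
collected in [proper_iff].  The rest is a case distinction on the position of
z: equal to 1, equal to 2 (with 3 in {x,y} or not), or neither.

In each case one looks at the two states missed by bba, or by aab.  If the one
other than 3 (resp. z) avoids the merged pair of the last letter, repeating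
that letter gives three missed states, whence b^2a^2 or a^2b^2.  Otherwise the
missed set is completely known.  Then either a change of letter makes progress
possible, which gives b^2ab^2 or a^2ba^2, or starting with the other square
does, or the sets missed by nonempty words all lie in the finite family {3},
{z}, {3,1}, {3,2}, {z,x}, {z,y}, so that at most two states are ever missed
([not_compressible_of_runs]). *)

(** * States missed by a word *)

Section Unreached.

Variables (Q : finType) (Sigma : Type) (delta : Q -> Sigma -> Q).
Implicit Types (C D : {set Q}) (c d : Sigma) (w : seq Sigma).

(** If C is the set of states missed by w, this is the set missed by wc. *)
Definition lose C c : {set Q} := ~: [set delta s c | s in ~: C].

Definition lost w : {set Q} := foldl lose set0 w.

Lemma lostE w : lost w = ~: image_word delta w.
Proof.
elim/last_ind: w => [|w c IHw].
  by apply/setP=> t; rewrite !inE; apply/esym/negbF/imsetP; exists t.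
rewrite /lost foldl_rcons -/(lost w) IHw /lose setCK; congr (~: _).
rewrite /image_word -imset_comp; apply: eq_imset => s /=.
by rewrite /act foldl_rcons.
Qed.

Lemma compressesE k w : compresses k delta w = (k <= #|lost w|).
Proof. by rewrite /compresses lostE [in RHS]cardsCs setCK. Qed.

(** Images never grow under a letter, so the number of missed states never drops. *)
Lemma leq_lose C c : #|C| <= #|lose C c|.
Proof.
rewrite -(leq_add2l #|~: C|) addnC cardsC.
rewrite -(cardsC [set delta s c | s in ~: C]) leq_add2r.
exact: leq_imset_card.
Qed.

Section OneLetter.

Variables (c : Sigma) (p q r : Q).
Hypothesis hc : letter_type delta c p q r.

Lemma letter_uniq : [/\ p != q, p != r & q != r].
Proof. by case: hc; rewrite /= !inE negb_or -!andbA => /and4P[]. Qed.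

Lemma letter_miss s : delta s c != r.
Proof.
case: hc => _ _ _ /setP/(_ r); rewrite !inE eqxx => /negP h.
by apply/eqP=> e; apply: h; rewrite -e; apply: imset_f.
Qed.

Lemma letter_onto t : t != r -> exists s, t = delta s c.
Proof.
case: hc => _ _ _ /setP/(_ t); rewrite !inE => <-.
by rewrite negbK => /imsetP[s _ ->]; exists s.
Qed.

Lemma letter_inj s t : s \notin [set p; q] -> delta s c = delta t c -> s = t.
Proof.
move=> hs e; have [//|n] := eqVneq s t.
by case: hc => _ _ h _; move: hs; rewrite -(h _ _ n e) !inE eqxx.
Qed.

Lemma letter_twin u v : u \in [set p; q] -> v \in [set p; q] ->
  delta u c = delta v c.
Proof.
by case: hc => _ e _ _; rewrite !inE => /orP[]/eqP-> /orP[]/eqP->.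
Qed.

Lemma letter_partner u : u \in [set p; q] ->
  exists2 v, v \in [set p; q] & v != u.
Proof.
have [pq _ _] := letter_uniq.
rewrite !inE => /orP[]/eqP->; first by exists q; rewrite ?(inE, eqxx, orbT) // eq_sym.
by exists p; rewrite ?inE ?eqxx.
Qed.

(** Forgetting u costs nothing since the other state of the merged pair has the
same image; that state may itself be in C, and then the common image is missed
exactly because both are. *)
Lemma lose_hit C u : u \in C -> u \in [set p; q] ->
  lose C c = r |: [set delta s c | s in C :\ u].
Proof.
move=> uC upq; apply/setP=> t; rewrite !inE.
have [->|tr] /= := eqVneq t r.
  by apply/imsetP=> -[s _ e]; have := letter_miss s; rewrite -e eqxx.
apply/idP/idP; last first.
  case/imsetP=> s; rewrite !inE => /andP[su sC] ->; apply/imsetP=> -[s'].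
  rewrite inE => s'C e; have ss' : s != s' by apply: contraNneq s'C => <-.
  case: hc => _ _ /(_ _ _ ss' e) h _.
  move: upq; rewrite -h !inE eq_sym (negPf su) /= => /eqP us'.
  by rewrite -us' uC in s'C.
have [s e] := letter_onto tr => ht.
have unreached s' : t = delta s' c -> s' \in C.
  by move=> es; apply: contraNT ht => s'C; apply/imsetP; exists s'; rewrite ?inE.
have [su|su] := eqVneq s u; last by apply/imsetP; exists s; rewrite // !inE su unreached.
have [v vpq vu] := letter_partner upq.
have ev : t = delta v c by rewrite e su; exact: letter_twin.
by apply/imsetP; exists v; rewrite // !inE vu unreached.
Qed.

(** Away from the merged pair the letter is injective, so a missed state has an
image with no other preimage. *)
Lemma lose_free C : p \notin C -> q \notin C ->
  lose C c = r |: [set delta s c | s in C].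
Proof.
move=> pC qC; apply/setP=> t; rewrite !inE.
have [->|tr] /= := eqVneq t r.
  by apply/imsetP=> -[s _ e]; have := letter_miss s; rewrite -e eqxx.
have [s e] := letter_onto tr; apply/idP/imsetP => [ht|[s1 s1C e1]].
  by exists s => //; apply: contraNT ht => sC; apply/imsetP; exists s; rewrite ?inE.
apply/imsetP=> -[s2]; rewrite inE => s2C e2.
have s1pq : s1 \notin [set p; q].
  by rewrite !inE; apply/norP; split; [apply: contraNneq pC | apply: contraNneq qC] => <-.
by rewrite -(letter_inj s1pq (etrans (esym e1) e2)) s1C in s2C.
Qed.

Lemma lose0 : lose set0 c = [set r].
Proof. by rewrite lose_free ?inE // imset0 setU0. Qed.

Lemma lose1_hit u : u \in [set p; q] -> lose [set u] c = [set r].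
Proof. by move=> upq; rewrite (lose_hit _ upq) ?set11 // setDv imset0 setU0. Qed.

Lemma lose1_free u : u \notin [set p; q] -> lose [set u] c = [set r; delta u c].
Proof.
rewrite !inE negb_or => /andP[up uq].
by rewrite lose_free ?inE 1?eq_sym // imset_set1.
Qed.

Lemma lose2_hit u v : u \in [set p; q] -> u != v ->
  lose [set u; v] c = [set r; delta v c].
Proof.
move=> upq uv; rewrite (lose_hit _ upq) ?set21 // setU1K ?imset_set1 //.
by rewrite inE.
Qed.

Lemma lose2_hitr u v : v \in [set p; q] -> u != v ->
  lose [set u; v] c = [set r; delta u c].
Proof. by move=> vpq uv; rewrite setUC lose2_hit // eq_sym. Qed.

(** The source of every growth beyond two missed states. *)
Lemma lose2_card u v : u != v ->
  (2 < #|lose [set u; v] c|) = (u \notin [set p; q]) && (v \notin [set p; q]).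
Proof.
move=> uv; have small (s t : Q) : (2 < #|[set s; t]|) = false.
  by rewrite cards2; case: (_ != _).
have [upq|upq] := boolP (u \in _); first by rewrite lose2_hit ?small.
have [vpq|vpq] /= := boolP (v \in _); first by rewrite lose2_hitr ?small.
have nuv : delta u c != delta v c by apply: contra_neq uv; exact: letter_inj.
move: upq vpq; rewrite !inE !negb_or => /andP[up uq] /andP[vp vq].
rewrite lose_free ?inE ?negb_or; last first.
- by rewrite !(eq_sym q) uq.
- by rewrite !(eq_sym p) up.
rewrite imsetU1 imset_set1 cardsU1 cards2 nuv !inE !(eq_sym r).
by rewrite !(negPf (letter_miss _)).
Qed.

Lemma lose1_card u : (2 < #|lose [set u] c|) = false.
Proof.
have [upq|upq] := boolP (u \in [set p; q]); first by rewrite lose1_hit ?cards1.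
by rewrite lose1_free // cards2; case: (_ != _).
Qed.

End OneLetter.
End Unreached.

(** * A letter that sends its missing state into its merged pair *)

Section OneRootedLetter.

Variables (Q : finType) (Sigma : Type) (delta : Q -> Sigma -> Q).
Variables (c : Sigma) (p q r : Q).
Hypotheses (hc : letter_type delta c p q r) (hrc : delta r c = p).

Lemma missing_notin : r \notin [set p; q].
Proof.
by have [_ pr qr] := letter_uniq hc; rewrite !inE !(eq_sym r) negb_or pr qr.
Qed.

Lemma letter_root s : delta s c = p -> s = r.
Proof. by rewrite -hrc => e; rewrite (letter_inj hc missing_notin (esym e)). Qed.

Lemma lose_missing : lose delta [set r] c = [set r; p].
Proof. by rewrite (lose1_free hc missing_notin) hrc. Qed.

(** After the letter c the set of missed states contains r, so this says that
a run of the letter c stalls as soon as it meets {p,q}. *)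
Lemma lose_missing_hit t : t \in [set p; q] ->
  lose delta [set r; t] c = [set r; p].
Proof.
move=> tpq; rewrite (lose2_hitr hc tpq) ?hrc //.
by apply: contraTneq tpq => <-; exact: missing_notin.
Qed.

(** The state r never obstructs a repetition of c, being outside {p,q}; so only
the other missed state has to avoid that pair. *)
Lemma lose_missing_free s : delta s c \notin [set p; q] ->
  2 < #|lose delta [set r; delta s c] c|.
Proof.
move=> h; rewrite (lose2_card hc) ?missing_notin //.
by rewrite eq_sym (letter_miss hc).
Qed.

End OneRootedLetter.

(** * Short words in two letters *)

Section TwoLetters.

Variables (Q : finType) (Sigma : Type) (delta : Q -> Sigma -> Q).
Variables (c d : Sigma) (p q r x y z : Q).
Hypotheses (hc : letter_type delta c p q r) (hrc : delta r c = p).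
Hypotheses (hd : letter_type delta d x y z) (hzd : delta z d = x).

Lemma compresses_ccc : compresses 3 delta [:: c; c; c] = false.
Proof.
rewrite compressesE /lost /= (lose0 hc) (lose_missing hc hrc).
by rewrite (lose_missing_hit hc) ?set21 // cards2; case: (_ != _).
Qed.

Lemma compresses_ccd : compresses 3 delta [:: c; c; d] =
  (r \notin [set x; y]) && (p \notin [set x; y]).
Proof.
rewrite compressesE /lost /= (lose0 hc) (lose_missing hc hrc) (lose2_card hd) //.
by have [_ pr _] := letter_uniq hc; rewrite eq_sym.
Qed.

Lemma compresses_cdc : compresses 3 delta [:: c; d; c] =
  [&& r \notin [set x; y], z \notin [set p; q] & delta r d \notin [set p; q]].
Proof.
rewrite compressesE /lost /= (lose0 hc).
have [rxy|rxy] /= := boolP (r \in _).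
  by rewrite (lose1_hit hd rxy) (lose1_card hc).
by rewrite (lose1_free hd rxy) (lose2_card hc) // eq_sym (letter_miss hd).
Qed.

Lemma compresses_cdd : compresses 3 delta [:: c; d; d] =
  (r \notin [set x; y]) && (delta r d \notin [set x; y]).
Proof.
rewrite compressesE /lost /= (lose0 hc).
have [rxy|rxy] /= := boolP (r \in _).
  by rewrite (lose1_hit hd rxy) (lose1_card hd).
rewrite (lose1_free hd rxy) (lose2_card hd) ?(missing_notin hd) //.
by rewrite eq_sym (letter_miss hd).
Qed.

(** With [compresses_ddcdd], and with the roles of the letters exchanged, this
covers all four witnessing words. *)
Lemma compresses_ddcc t : delta t c \notin [set p; q] ->
  lost delta [:: d; d; c] = [set r; delta t c] ->
  compresses 3 delta [:: d; d; c; c].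
Proof.
move=> tpq e; rewrite compressesE /lost.
rewrite -[[:: d; d; c; c]]/([:: d; d; c] ++ [:: c]).
by rewrite foldl_cat -/(lost _ _) e; apply: (lose_missing_free hc).
Qed.

Lemma compresses_ddcdd t : delta t d \notin [set x; y] ->
  lost delta [:: d; d; c; d] = [set z; delta t d] ->
  compresses 3 delta [:: d; d; c; d; d].
Proof.
move=> txy e; rewrite compressesE /lost.
rewrite -[[:: d; d; c; d; d]]/([:: d; d; c; d] ++ [:: d]).
by rewrite foldl_cat -/(lost _ _) e; apply: (lose_missing_free hd).
Qed.

End TwoLetters.

(** * Properness, and families of missed sets that cannot grow *)

Lemma not_compressible_of_closed (Q : finType) (delta : Q -> letter -> Q)
    (F : seq {set Q}) :
  set0 \in F -> (forall C, C \in F -> #|C| <= 2) ->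
  (forall C c, C \in F -> lose delta C c \in F) -> ~ compressible 3 delta.
Proof.
move=> F0 F2 Fc [w]; rewrite compressesE; apply/negP; rewrite -leqNgt; apply: F2.
by elim/last_ind: w => [//|w c IH]; rewrite /lost foldl_rcons; apply: Fc.
Qed.

Section Binary.

Variables (Q : finType) (delta : Q -> letter -> Q).
Variables (q1 q2 q3 x y z : Q).
Hypotheses (ha : letter_type delta La q1 q2 q3) (h3a : delta q3 La = q1).
Hypotheses (hb : letter_type delta Lb x y z) (hzb : delta z Lb = x).

(** The tests say, in this order, that aab, bba, aba, bab, abb, baa miss at most
two states; aaa and bbb always do. *)
Lemma proper_iff : proper_automaton delta <->
  [&& (q3 \in [set x; y]) || (q1 \in [set x; y]),
      (z \in [set q1; q2]) || (x \in [set q1; q2]),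
      [|| q3 \in [set x; y], z \in [set q1; q2] | delta q3 Lb \in [set q1; q2]],
      [|| z \in [set q1; q2], q3 \in [set x; y] | delta z La \in [set x; y]],
      (q3 \in [set x; y]) || (delta q3 Lb \in [set x; y])
    & (z \in [set q1; q2]) || (delta z La \in [set q1; q2])].
Proof.
have notin := (compresses_ccd ha h3a hb, compresses_ccd hb hzb ha,
  compresses_cdc ha hb, compresses_cdc hb ha,
  compresses_cdd ha hb, compresses_cdd hb ha).
split=> [h|/and5P[aab bba aba bab /andP[abb baa]]].
  have nc c1 c2 c3 : ~~ compresses 3 delta [:: c1; c2; c3] by exact: h.
  do ![apply/andP; split].
  - by move: (nc La La Lb); rewrite notin negb_and !negbK.
  - by move: (nc Lb Lb La); rewrite notin negb_and !negbK.
  - by move: (nc La Lb La); rewrite notin !negb_and !negbK.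
  - by move: (nc Lb La Lb); rewrite notin !negb_and !negbK.
  - by move: (nc La Lb Lb); rewrite notin negb_and !negbK.
  - by move: (nc Lb La La); rewrite notin negb_and !negbK.
case=> [|c1 [|c2 [|c3 [|//]]]] // _.
by case: c1; case: c2; case: c3;
  rewrite ?(compresses_ccc ha h3a) ?(compresses_ccc hb hzb) ?notin ?negb_and ?negbK.
Qed.

(** Repeating a letter keeps such a family stable by [lose_missing_hit], so only
the changes of letter need to be checked.  The lists sa and sb vary because in
some cases {3,2} or {z,y} is never missed and its successors leave the
family. *)
Lemma not_compressible_of_runs (sa sb : seq Q) (F := set0 :: [set q3] :: [set z]
    :: [seq [set q3; t] | t <- sa] ++ [seq [set z; t] | t <- sb]) :
  q1 \in sa -> all (mem [set q1; q2]) sa ->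
  x \in sb -> all (mem [set x; y]) sb ->
  all (fun C => lose delta C Lb \in F)
    ([set q3] :: [seq [set q3; t] | t <- sa]) ->
  all (fun C => lose delta C La \in F)
    ([set z] :: [seq [set z; t] | t <- sb]) ->
  ~ compressible 3 delta.
Proof.
move=> /= q1sa /allP sa12 xsb /allP sbxy /andP[b3 /allP bsa] /andP[az /allP asb].
have Fa t : t \in sa -> [set q3; t] \in F.
  by move=> ht; rewrite !inE mem_cat (map_f (fun t => [set q3; t])) ?orbT.
have Fb t : t \in sb -> [set z; t] \in F.
  by move=> ht; rewrite !inE mem_cat orbC (map_f (fun t => [set z; t])) ?orbT.
have [F0 F3 Fz] : [/\ set0 \in F, [set q3] \in F & [set z] \in F].
  by rewrite !inE !eqxx !orbT.
have F_ind (P : {set Q} -> Prop) : P set0 -> P [set q3] -> P [set z] ->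
    {in sa, forall t, P [set q3; t]} -> {in sb, forall t, P [set z; t]} ->
    forall C, C \in F -> P C.
  move=> P0 P3 Pz Pa Pb C; rewrite !inE mem_cat.
  by case/or4P=> [/eqP->|/eqP->|/eqP->|/orP[] /mapP[t ht ->]] //; [apply: Pa|apply: Pb].
apply: (@not_compressible_of_closed _ _ F) => //.
  by apply: F_ind => [|||t _|t _]; rewrite ?cards0 ?cards1 ?cards2 //; case: (_ != _).
move=> C c; move: C; case: c; apply: F_ind => [|||t ht|t ht].
- by rewrite (lose0 ha).
- by rewrite (lose_missing ha h3a) Fa.
- exact: az.
- by rewrite (lose_missing_hit ha h3a) ?Fa //; exact: sa12.
- by apply: asb; apply: (map_f (fun t => [set z; t])).
- by rewrite (lose0 hb).
- exact: b3.
- by rewrite (lose_missing hb hzb) Fb.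
- by apply: bsa; apply: (map_f (fun t => [set q3; t])).
- by rewrite (lose_missing_hit hb hzb) ?Fb //; exact: sbxy.
Qed.

End Binary.

(** * The four positions of the state z *)

Definition short_word (Q : finType) (delta : Q -> letter -> Q) :=
  [\/ compresses 3 delta [:: Lb; Lb; La; La],
      compresses 3 delta [:: Lb; Lb; La; Lb; Lb],
      compresses 3 delta [:: La; La; Lb; Lb]
    | compresses 3 delta [:: La; La; Lb; La; La]].

(** What has to be shown about the condition R that governs one position of z.
The word provided by R makes the automaton compressible, so R is then
equivalent to being proper and 3-compressible. *)
Definition settles (Q : finType) (delta : Q -> letter -> Q) (R : Prop) :=
  [/\ R -> proper_automaton delta, R -> short_word delta
    & proper_automaton delta -> compressible 3 delta -> R].

(** As z = 1 is not in {x,y}, testing aab shows that properness forces 3 into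
{x,y}.  If x = 3, then aa and bb miss the same set {1,3} and nothing else of
size two occurs.  If y = 3, then bba misses {3,xa}, which a enlarges unless
xa = 2; in that case bbab misses {1,2b}, which b enlarges unless 2b = 3. *)
Lemma settles_missing1 (Q : finType) (delta : Q -> letter -> Q)
    (q1 q2 q3 x y : Q) :
  letter_type delta La q1 q2 q3 -> delta q3 La = q1 ->
  letter_type delta Lb x y q1 -> delta q1 Lb = x ->
  settles delta (y = q3 /\ (delta x La <> q2 \/ delta q2 Lb <> q3)).
Proof.
move=> ha h3a hb hzb.
have [q12 q13 q23] := letter_uniq ha; have [xy xz yz] := letter_uniq hb.
have q1xy := missing_notin hb.
split.
- case=> y3 _; apply/(proper_iff ha h3a hb hzb).
  by rewrite -y3 !inE !eqxx !orbT.
- case=> y3 h.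
  have bba : lost delta [:: Lb; Lb; La] = [set q3; delta x La].
    rewrite /lost /= (lose0 hb) (lose_missing hb hzb).
    by rewrite (lose2_hit ha) ?set21 1?eq_sym.
  have xa1 : delta x La != q1.
    by apply: contra_neq xy => /(letter_root ha h3a) ->.
  have [xa2|xa2] := eqVneq (delta x La) q2; last first.
    by constructor 1; apply: (compresses_ddcc ha _ bba); rewrite !inE negb_or xa1.
  case: h => // /eqP q2b; constructor 2; apply: (compresses_ddcdd hb (t := q2)).
    rewrite !inE y3 negb_or q2b andbT.
    by apply: contra_neq q12 => /(letter_root hb hzb).
  rewrite -[[:: _; _; _; _]]/([:: Lb; Lb; La] ++ [:: Lb]) /lost foldl_cat -/(lost _ _).
  by rewrite bba xa2 /= (lose2_hit hb) // -?y3 ?set22 // y3 eq_sym.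
move=> /(proper_iff ha h3a hb hzb)/and5P[+ _ _ _ _] cmp.
rewrite (negPf q1xy) orbF !inE => /orP[]/eqP q3E.
  have b3 : lose delta [set q3] Lb = [set q1] by rewrite (lose1_hit hb) // q3E set21.
  have b31 : lose delta [set q3; q1] Lb = [set q1; x].
    by rewrite (lose2_hit hb) ?hzb // q3E ?set21.
  have a1 : lose delta [set q1] La = [set q3] by rewrite (lose1_hit ha) ?set21.
  have a1x : lose delta [set q1; x] La = [set q3; q1].
    by rewrite -q3E (lose2_hit ha) ?set21 // h3a.
  suff: ~ compressible 3 delta by [].
  by apply: (not_compressible_of_runs ha h3a hb hzb
    (sa := [:: q1]) (sb := [:: x]));
    rewrite /= ?b3 ?b31 ?a1 ?a1x ?(inE, eqxx, orbT).
split=> //.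
have [xa2|/eqP] := eqVneq (delta x La) q2; last by left.
have [q2b|/eqP] := eqVneq (delta q2 Lb) q3; last by right.
have yhit : q3 \in [set x; y] by rewrite q3E set22.
have b3 : lose delta [set q3] Lb = [set q1] by rewrite (lose1_hit hb).
have b31 : lose delta [set q3; q1] Lb = [set q1; x].
  by rewrite (lose2_hit hb) ?hzb // eq_sym.
have b32 : lose delta [set q3; q2] Lb = [set q3; q1].
  by rewrite (lose2_hit hb) ?q2b 1?eq_sym // setUC.
have a1 : lose delta [set q1] La = [set q3] by rewrite (lose1_hit ha) ?set21.
have a1x : lose delta [set q1; x] La = [set q3; q2].
  by rewrite (lose2_hit ha) ?set21 ?xa2 // eq_sym.
have a1y : lose delta [set q1; y] La = [set q3; q1].
  by rewrite -q3E (lose2_hit ha) ?set21 ?h3a.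
suff: ~ compressible 3 delta by [].
by apply: (not_compressible_of_runs ha h3a hb hzb
    (sa := [:: q1; q2]) (sb := [:: x; y]));
  rewrite /= ?b3 ?b31 ?b32 ?a1 ?a1x ?a1y ?(inE, eqxx, orbT).
Qed.

(** The condition is properness itself, and it suffices: bba misses {3,xa}; if
xa = 2 then b enlarges it, as neither 3 nor z = 2 lies in {x,y}, and otherwise
a does. *)
Lemma settles_missing2_out (Q : finType) (delta : Q -> letter -> Q)
    (q1 q2 q3 x y : Q) :
  letter_type delta La q1 q2 q3 -> delta q3 La = q1 ->
  letter_type delta Lb x y q2 -> delta q2 Lb = x ->
  q3 \notin [set x; y] ->
  settles delta (q1 \in [set x; y] /\ delta q3 Lb \in [set x; y]).
Proof.
move=> ha h3a hb hzb q3xy.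
have [q12 q13 q23] := letter_uniq ha; have [xy xz yz] := letter_uniq hb.
have properE : proper_automaton delta <->
    q1 \in [set x; y] /\ delta q3 Lb \in [set x; y].
  apply: (iff_trans (proper_iff ha h3a hb hzb)).
  by rewrite (negPf q3xy) set22 /= andbT; split=> /andP.
split=> [/properE//|[q1xy _]|/properE//].
have x3 : x != q3 by apply: contraNneq q3xy => <-; exact: set21.
have bba : lost delta [:: Lb; Lb; La] = [set q3; delta x La].
  by rewrite /lost /= (lose0 hb) (lose_missing hb hzb) (lose2_hit ha) ?set22 1?eq_sym.
have [xa2|xa2] := eqVneq (delta x La) q2.
  constructor 2; rewrite compressesE.
  rewrite -[[:: _; _; _; _; _]]/([:: Lb; Lb; La] ++ [:: Lb; Lb]) /lost foldl_cat.
  rewrite -/(lost _ _) bba xa2 /=; apply: leq_trans (leq_lose _ _ _).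
  by rewrite (lose2_card hb) 1?eq_sym // q3xy (missing_notin hb).
constructor 1; apply: (compresses_ddcc ha _ bba); rewrite !inE negb_or xa2 andbT.
by apply: contra_neq x3 => /(letter_root ha h3a).
Qed.

(** Such an automaton is always proper.  The word aab misses {2,1b}, which b
enlarges unless 1b = y.  If 1b = y, let q be the element of {x,y} other than 3:
the set {2,q} is missed after aab if q = y and after bb if q = x, and it becomes
{3,qa}, which a enlarges unless qa = 2. *)
Lemma settles_missing2_in (Q : finType) (delta : Q -> letter -> Q)
    (q1 q2 q3 x y : Q) :
  letter_type delta La q1 q2 q3 -> delta q3 La = q1 ->
  letter_type delta Lb x y q2 -> delta q2 Lb = x ->
  q3 \in [set x; y] ->
  settles delta (forall q : Q, q \in [set x; y] :\ q3 ->
    delta q La <> q2 \/ delta q1 Lb <> y).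
Proof.
move=> ha h3a hb hzb q3xy.
have [q12 q13 q23] := letter_uniq ha; have [xy xz yz] := letter_uniq hb.
have q1b : delta q1 Lb != x by apply: contra_neq q12 => /(letter_root hb hzb).
have aab : lost delta [:: La; La; Lb] = [set q2; delta q1 Lb].
  by rewrite /lost /= (lose0 ha) (lose_missing ha h3a) (lose2_hit hb) 1?eq_sym.
split.
- move=> _; apply/(proper_iff ha h3a hb hzb).
  by rewrite q3xy set22.
- move=> h; have [q1y|q1y] := eqVneq (delta q1 Lb) y; last first.
    constructor 3; apply: (compresses_ddcc hb _ aab).
    by rewrite !inE negb_or q1b q1y.
  move: q3xy; rewrite !inE => /orP[]/eqP q3E.
    have hy : y \in [set x; y] :\ q3 by rewrite !inE q3E eqxx orbT eq_sym xy.
    case: (h _ hy) => // /eqP ya2.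
    constructor 4; apply: (compresses_ddcdd ha (t := y)).
      rewrite !inE negb_or ya2 andbT; apply: contra_neq xy.
      by move/(letter_root ha h3a) ->.
    rewrite -[[:: _; _; _; _]]/([:: La; La; Lb] ++ [:: La]) /lost foldl_cat -/(lost _ _).
    by rewrite aab q1y /= (lose2_hit ha) ?set22 1?eq_sym.
  have hx : x \in [set x; y] :\ q3 by rewrite !inE q3E eqxx xy.
  case: (h _ hx) => // /eqP xa2.
  constructor 1; apply: (compresses_ddcc ha (t := x)).
    rewrite !inE negb_or xa2 andbT; apply: contra_neq xy.
    by move/(letter_root ha h3a) ->.
  by rewrite /lost /= (lose0 hb) (lose_missing hb hzb) (lose2_hit ha) ?set22 1?eq_sym.
move=> _ cmp q; rewrite !inE => /andP[q3q qxy].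
have [qa2|/eqP] := eqVneq (delta q La) q2; last by left.
have [q1y|/eqP] := eqVneq (delta q1 Lb) y; last by right.
have b3 : lose delta [set q3] Lb = [set q2] by rewrite (lose1_hit hb).
have b31 : lose delta [set q3; q1] Lb = [set q2; y].
  by rewrite (lose2_hit hb) ?q1y // eq_sym.
have b32 : lose delta [set q3; q2] Lb = [set q2; x].
  by rewrite (lose2_hit hb) ?hzb // eq_sym.
have a2 : lose delta [set q2] La = [set q3] by rewrite (lose1_hit ha) ?set22.
have a2q : lose delta [set q2; q] La = [set q3; q2].
  rewrite (lose2_hit ha) ?set22 ?qa2 //.
  by apply: contraTneq qxy => <-; rewrite !(eq_sym q2) negb_or xz yz.
have a23 : lose delta [set q2; q3] La = [set q3; q1].
  by rewrite (lose2_hit ha) ?set22 ?h3a.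
suff: ~ compressible 3 delta by [].
have [a2x a2y] : lose delta [set q2; x] La \in [:: [set q3; q1]; [set q3; q2]] /\
    lose delta [set q2; y] La \in [:: [set q3; q1]; [set q3; q2]].
  move: q3xy q3q qxy; rewrite !inE => /orP[]/eqP <- /negPf->; rewrite ?orbF => /eqP <-;
    by rewrite a2q a23 !eqxx ?orbT.
apply: (not_compressible_of_runs ha h3a hb hzb
    (sa := [:: q1; q2]) (sb := [:: x; y])).
- by rewrite inE eqxx.
- by rewrite /= !inE !eqxx orbT.
- by rewrite inE eqxx.
- by rewrite /= !inE !eqxx orbT.
- by rewrite /= b3 b31 b32 !inE !eqxx !orbT.
rewrite /= a2; move: a2x a2y; rewrite !inE eqxx !orbT /=.
by move=> /orP[]/eqP-> /orP[]/eqP->; rewrite !eqxx !orbT.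
Qed.

(** Testing bba and baa gives x, za in {1,2}.  If y = 3, then aab misses {z,1b}
and bbab misses {z,2b}; neither 1b nor 2b is x, and they are not both 3, since
b merges only x and y = 3.  If y is not 3, then 3b is in {x,y}, and the missed
sets are trapped: for z = 3 one has 3b = x, and otherwise 3b = y, za = 2 and
{x,y} = {1,2}. *)
Lemma settles_missing_other (Q : finType) (delta : Q -> letter -> Q)
    (q1 q2 q3 x y z : Q) :
  letter_type delta La q1 q2 q3 -> delta q3 La = q1 ->
  letter_type delta Lb x y z -> delta z Lb = x ->
  z \notin [set q1; q2] ->
  settles delta
    [/\ x \in [set q1; q2], delta z La \in [set q1; q2] & y = q3].
Proof.
move=> ha h3a hb hzb z12.
have [q12 q13 q23] := letter_uniq ha; have [xy xz yz] := letter_uniq hb.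
have q3_12 := missing_notin ha; have zxy := missing_notin hb.
have [zq1 zq2] : z != q1 /\ z != q2 by move: z12; rewrite !inE negb_or => /andP.
have za2 : z != q3 -> delta z La \in [set q1; q2] -> delta z La = q2.
  by rewrite !inE => zq3 /orP[/eqP/(letter_root ha h3a)/eqP|/eqP//]; rewrite (negPf zq3).
have bz s : s != z -> delta s Lb != x.
  by apply: contra_neq => /(letter_root hb hzb).
split.
- case=> x12 za12 y3; apply/(proper_iff ha h3a hb hzb).
  by rewrite -y3 set22 x12 za12 !orbT.
- case=> x12 za12 y3; have {za12}za : delta z La = q2 by rewrite za2 // -y3 eq_sym.
  have q3xy : q3 \in [set x; y] by rewrite -y3 set22.
  have [q1b q2b] : delta q1 Lb != x /\ delta q2 Lb != x by rewrite !bz // eq_sym.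
  have aab : lost delta [:: La; La; Lb] = [set z; delta q1 Lb].
    by rewrite /lost /= (lose0 ha) (lose_missing ha h3a) (lose2_hit hb) 1?eq_sym.
  have [q1y|q1y] := eqVneq (delta q1 Lb) y; last first.
    by constructor 3; apply: (compresses_ddcc hb _ aab); rewrite !inE negb_or q1b.
  have [q2y|q2y] := eqVneq (delta q2 Lb) y.
    have := q3_12; case: hb => _ _ /(_ _ _ q12 (etrans q1y (esym q2y))) -> _.
    by rewrite q3xy.
  constructor 2; apply: (compresses_ddcdd hb (t := q2)).
    by rewrite !inE negb_or q2b q2y.
  rewrite /lost /= (lose0 hb) (lose_missing hb hzb).
  by rewrite (lose2_hitr ha x12) 1?eq_sym // za (lose2_hit hb) // eq_sym.
move=> /(proper_iff ha h3a hb hzb).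
rewrite (negPf z12) /= => /and5P[aab x12 aba _ /andP[abb za12]] cmp; split=> //.
have q3x : q3 != x by apply: contraNneq q3_12 => ->.
have [//|yq3] := eqVneq y q3.
have q3xy : q3 \notin [set x; y] by rewrite !inE negb_or q3x eq_sym.
move: aab aba abb; rewrite (negPf q3xy) /= => q1xy q3b12 q3bxy.
suff: ~ compressible 3 delta by [].
have b31 : lose delta [set q3; q1] Lb = [set z; delta q3 Lb].
  by rewrite (lose2_hitr hb) // eq_sym.
have b3 : lose delta [set q3] Lb = [set z; delta q3 Lb] by rewrite (lose1_free hb).
have az : lose delta [set z] La = [set q3; delta z La] by rewrite (lose1_free ha).
have azx : lose delta [set z; x] La = [set q3; delta z La].
  by rewrite (lose2_hitr ha) // eq_sym.
have [zq3|zq3] := eqVneq z q3.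
  have q3b : delta q3 Lb = x by rewrite -zq3.
  have za : delta z La = q1 by rewrite zq3.
  rewrite q3b in b3 b31; rewrite za in az azx.
  by apply: (not_compressible_of_runs ha h3a hb hzb
    (sa := [:: q1]) (sb := [:: x]));
    rewrite /= ?b3 ?b31 ?az ?azx ?(inE, eqxx, orbT).
have q3b : delta q3 Lb = y.
  have q3bx : delta q3 Lb != x by rewrite bz // eq_sym.
  by move: q3bxy; rewrite !inE (negPf q3bx) => /eqP.
have y12 : y \in [set q1; q2] by rewrite -q3b.
have q2xy : q2 \in [set x; y].
  move: x12 y12; rewrite !inE => /orP[/eqP x1|/eqP->]; last by rewrite eqxx.
  by case/orP=> /eqP y1; [rewrite x1 y1 eqxx in xy | rewrite y1 eqxx orbT].
have b32 : lose delta [set q3; q2] Lb = [set z; delta q3 Lb].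
  by rewrite (lose2_hitr hb) // eq_sym.
have azy : lose delta [set z; y] La = [set q3; delta z La].
  by rewrite (lose2_hitr ha) // eq_sym.
rewrite q3b in b3 b31 b32; rewrite (za2 zq3 za12) in az azx azy.
by apply: (not_compressible_of_runs ha h3a hb hzb
    (sa := [:: q1; q2]) (sb := [:: x; y]));
  rewrite /= ?b3 ?b31 ?b32 ?az ?azx ?azy ?(inE, eqxx, orbT).
Qed.

Theorem proposition25 (Q : finType) (delta : Q -> letter -> Q)
    (q1 q2 q3 x y z : Q)
    (ha : letter_type delta La q1 q2 q3) (h3a : delta q3 La = q1)
    (hb : letter_type delta Lb x y z) (hzb : delta z Lb = x) :
  ((proper_automaton delta /\ compressible 3 delta) <->
   [/\ z = q1 -> y = q3 /\ (delta x La <> q2 \/ delta q2 Lb <> q3),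
       z = q2 -> q3 \notin [set x; y] ->
         q1 \in [set x; y] /\ delta q3 Lb \in [set x; y],
       z = q2 -> q3 \in [set x; y] ->
         forall q : Q, q \in [set x; y] :\ q3 ->
           delta q La <> q2 \/ delta q1 Lb <> y
     & (* Read as "if z is not in {1,2}, then x, za are in {1,2} and y = 3";
          with the facts on x and za as premises the equivalence fails. *)
       z \notin [set q1; q2] ->
         [/\ x \in [set q1; q2], delta z La \in [set q1; q2] & y = q3]])
  /\
  (proper_automaton delta /\ compressible 3 delta ->
   [\/ compresses 3 delta [:: Lb; Lb; La; La],
       compresses 3 delta [:: Lb; Lb; La; Lb; Lb],
       compresses 3 delta [:: La; La; Lb; Lb]
     | compresses 3 delta [:: La; La; Lb; La; La]]).
Proof.
set conditions := and4 _ _ _ _.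
suff [suff_proper suff_short nec] : settles delta conditions.
  have nec' : proper_automaton delta /\ compressible 3 delta -> conditions.
    by case; exact: nec.
  split; last by move/nec'/suff_short.
  split=> // h; split; first exact: suff_proper.
  by case: (suff_short h); eexists; eassumption.
(* For a given z three of the four conditions are vacuous, so it is enough to
   settle the remaining one. *)
have transfer R : (conditions <-> R) -> settles delta R -> settles delta conditions.
  case=> cR Rc [RP RW PR]; split=> [/cR/RP|/cR/RW|hp hc] //.
  exact: Rc (PR hp hc).
have [q12 _ _] := letter_uniq ha.
have [zq1|zq1] := eqVneq z q1.
  subst z; apply: transfer (settles_missing1 ha h3a hb hzb).
  split=> [[h _ _ _]|h]; first exact: h.
  split=> // [e|e|]; [by rewrite e eqxx in q12..|by rewrite set21].
have [zq2|zq2] := eqVneq z q2.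
  subst z; have [q3xy|q3xy] := boolP (q3 \in [set x; y]).
    apply: transfer (settles_missing2_in ha h3a hb hzb q3xy).
    split=> [[_ _ h _]|h]; first exact: h.
    by split=> // [e|_|]; [rewrite e eqxx in q12|rewrite q3xy|rewrite set22].
  apply: transfer (settles_missing2_out ha h3a hb hzb q3xy).
  split=> [[_ h _ _]|h]; first exact: h.
  by split=> // [e|_ h3|]; [rewrite e eqxx in q12|rewrite h3 in q3xy|rewrite set22].
have z12 : z \notin [set q1; q2] by rewrite !inE negb_or zq1.
apply: transfer (settles_missing_other ha h3a hb hzb z12).
split=> [[_ _ _ h]|h]; first exact: h.
by split=> // e; [rewrite e eqxx in zq1|rewrite e eqxx in zq2..].
Qed.
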